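(* Let $\Gamma$ be a polycyclic-by-finite group and let $\tau_\Gamma$ denote its maximal finite normal subgroup. Then the groups $\mathrm{Aut}(\Gamma)$ and $\mathrm{Aut}(\Gamma/\tau_\Gamma)$ are commensurable. If $\mathrm{Aut}(\Gamma/\tau_\Gamma)$ is an arithmetic group then $\mathrm{Aut}(\Gamma)$ is an arithmetic group too. If $\mathrm{Aut}(\Gamma)$ is an arithmetic group then $\mathrm{Aut}(\Gamma/\tau_\Gamma)$ contains a subgroup of finite index which is an arithmetic group.
   Context: A group is polycyclic-by-finite if it has a polycyclic subgroup of finite index; such a group has a maximal finite normal subgroup. Two abstract groups $G,G'$ are commensurable if they contain finite index subgroups $G_0\le G$ and $G_0'\le G'$ which are isomorphic. A $\mathbb{Q}$-defined linear algebraic group is a subgroup $G\le \mathrm{GL}(n,\mathbb{C})$ ($n\in\mathbb{N}$) which is also an affine algebraic set defined by polynomials with rational coefficients; for a subring $R\le\mathbb{C}$ put $G(R)=G\cap \mathrm{GL}(n,R)$. A subgroup $\Delta\le G(\mathbb{Q})$ is an arithmetic subgroup of $G$ if $\Delta\cap G(\mathbb{Z})$ has finite index in both $\Delta$ and $G(\mathbb{Z})$. An abstract group is called arithmetic if it is isomorphic to an arithmetic subgroup of some $\mathbb{Q}$-defined linear algebraic group. *)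

(* Defs.v *)
From HB Require Import structures.
From mathcomp Require Import all_boot all_order all_algebra.
From mathcomp Require Import monoid generic_quotient.
From mathcomp Require Import boolp classical_sets cardinality reals.
From mathcomp Require Import complex.
(* mpoly is not imported: its notations clash with those of classical_sets. *)
From mathcomp Require mpoly.

Set Implicit Arguments.
Unset Strict Implicit.
Unset Printing Implicit Defensive.

Import GRing.Theory.
Local Open Scope classical_set_scope.
Local Open Scope quotient_scope.
Local Open Scope group_scope.

(* Groups are [groupType]s, possibly infinite; subgroups of [G] are the
   [H : groupClosed G].  Their membership predicates are boolean, but under the
   classical axioms of [boolp] every subset is of this form, and every type
   has the choice structure that [groupType] requires. *)

Definition subg (G : groupType) (H : groupClosed G) := {x : G | x \in H}.

Section SubGroup.
Variables (G : groupType) (H : groupClosed G).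

HB.instance Definition _ := SubChoice.on (subg H).

Fact subg_closed : group_closed [pred x : G | x \in H].
Proof. by split=> [|x y]; [exact: gpred1 | exact: gpredF]. Qed.

HB.instance Definition _ :=
  SubChoice_isSubGroup.Build G [pred x : G | x \in H] (subg H) subg_closed.

End SubGroup.

Record normal_subgroup (G : groupType) := NormalSubgroup {
  nsub :> groupClosed G;
  nsubJ : forall x y : G, x \in nsub -> x ^ y \in nsub
}.

Section QuotientRelation.
Variables (G : groupType) (N : normal_subgroup G).

Definition coset_rel (x y : G) : bool := x^-1 * y \in N.

Fact coset_rel_refl : reflexive coset_rel.
Proof. by move=> x; rewrite /coset_rel mulVg gpred1. Qed.

Fact coset_rel_sym : symmetric coset_rel.
Proof. by move=> x y; rewrite /coset_rel -[LHS]gpredV invgM invgK. Qed.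

Fact coset_rel_trans : transitive coset_rel.
Proof.
move=> y x z xy yz; rewrite /coset_rel -[z](mulVKg y) mulgA.
exact: gpredM xy yz.
Qed.

Canonical coset_equiv :=
  EquivRel coset_rel coset_rel_refl coset_rel_sym coset_rel_trans.

End QuotientRelation.

Definition quot (G : groupType) (N : normal_subgroup G) :=
  {eq_quot (@coset_rel G N)}.

Section QuotientGroup.
Variables (G : groupType) (N : normal_subgroup G).

HB.instance Definition _ := Choice.on (quot N).
HB.instance Definition _ := EqQuotient.on (quot N).

Definition quot_pi (x : G) : quot N := \pi_(quot N) x.
Definition quot_one : quot N := quot_pi 1.
Definition quot_mul (x y : quot N) : quot N := quot_pi (repr x * repr y).
Definition quot_inv (x : quot N) : quot N := quot_pi (repr x)^-1.

Lemma quot_piP x y : quot_pi x = quot_pi y <-> x^-1 * y \in N.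
Proof. by split=> [/eqquotP|h]; last exact/eqquotP. Qed.

Lemma quot_reprK x : quot_pi (repr x) = x.
Proof. exact: reprK. Qed.

Lemma quot_piM x y : quot_mul (quot_pi x) (quot_pi y) = quot_pi (x * y).
Proof.
apply/quot_piP; set x' := repr _; set y' := repr _.
have hx : x'^-1 * x \in N by apply/quot_piP; rewrite quot_reprK.
have hy : y'^-1 * y \in N by apply/quot_piP; rewrite quot_reprK.
have -> : (x' * y')^-1 * (x * y) = (x'^-1 * x) ^ y' * (y'^-1 * y).
  by rewrite /conjg invgM !mulgA mulgK.
by apply: gpredM => //; apply: nsubJ.
Qed.

Lemma quot_piV x : quot_inv (quot_pi x) = quot_pi x^-1.
Proof.
apply/quot_piP; set x' := repr _; rewrite invgK.
have hx : x'^-1 * x \in N by apply/quot_piP; rewrite quot_reprK.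
have -> : x' * x^-1 = ((x'^-1 * x)^-1) ^ x'^-1.
  by rewrite /conjg invgM !invgK !mulgA mulgK.
by apply: nsubJ; rewrite gpredV.
Qed.

Fact quot_mulA : associative quot_mul.
Proof.
move=> x y z; rewrite -(quot_reprK x) -(quot_reprK y) -(quot_reprK z).
by rewrite !quot_piM mulgA.
Qed.

Fact quot_mul1g : left_id quot_one quot_mul.
Proof. by move=> x; rewrite -(quot_reprK x) quot_piM mul1g. Qed.

Fact quot_mulg1 : right_id quot_one quot_mul.
Proof. by move=> x; rewrite -(quot_reprK x) quot_piM mulg1. Qed.

Fact quot_mulVg : left_inverse quot_one quot_inv quot_mul.
Proof. by move=> x; rewrite -(quot_reprK x) quot_piV quot_piM mulVg. Qed.

Fact quot_mulgV : right_inverse quot_one quot_inv quot_mul.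
Proof. by move=> x; rewrite -(quot_reprK x) quot_piV quot_piM mulgV. Qed.

HB.instance Definition _ := isGroup.Build (quot N)
  quot_mulA quot_mul1g quot_mulg1 quot_mulVg quot_mulgV.

End QuotientGroup.

Record aut (G : groupType) := Aut {
  aut_fun :> {multiplicative G -> G};
  aut_bij : bijective aut_fun
}.

Section AutomorphismGroup.
Variable G : groupType.

HB.instance Definition _ := gen_eqMixin (aut G).
HB.instance Definition _ := gen_choiceMixin (aut G).

Implicit Types f g h : aut G.

Lemma autP f g : f =1 g -> f = g.
Proof.
case: f g => [[f [[fM]]] fb] [[g [[gM]]] gb] /= fg.
move/funext: fg gM gb => <-{g} gM gb.
by rewrite (Prop_irrelevance gM fM) in gb *; congr Aut; exact: Prop_irrelevance.
Qed.

Definition aut_one : aut G := Aut (aut_fun := idfun) (inv_bij (@erefl G)).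

Definition aut_mul f g : aut G :=
  Aut (aut_fun := aut_fun f \o aut_fun g) (bij_comp (aut_bij f) (aut_bij g)).

Lemma aut_surj f y : exists x, f x = y.
Proof. by have [g _ fK] := aut_bij f; exists (g y); rewrite fK. Qed.

Definition aut_inv_fun f (y : G) : G := sval (cid (aut_surj f y)).

Lemma aut_inv_funK f : cancel (aut_inv_fun f) (aut_fun f).
Proof. by move=> y; rewrite /aut_inv_fun; case: cid. Qed.

Lemma aut_funK f : cancel (aut_fun f) (aut_inv_fun f).
Proof.
by move=> x; apply: (bij_inj (aut_bij f)); rewrite aut_inv_funK.
Qed.

Fact aut_inv_funM f : {morph aut_inv_fun f : x y / x * y}.
Proof.
move=> x y; apply: (bij_inj (aut_bij f)).
by rewrite gmulfM !aut_inv_funK.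
Qed.

HB.instance Definition _ f :=
  isMultiplicative.Build G G (aut_inv_fun f) (aut_inv_funM f).

Definition aut_inv f : aut G :=
  Aut (aut_fun := aut_inv_fun f) (Bijective (aut_inv_funK f) (aut_funK f)).

Fact aut_mulA : associative aut_mul.
Proof. by move=> f g h; exact/autP. Qed.

Fact aut_mul1g : left_id aut_one aut_mul.
Proof. by move=> f; exact/autP. Qed.

Fact aut_mulg1 : right_id aut_one aut_mul.
Proof. by move=> f; exact/autP. Qed.

Fact aut_mulVg : left_inverse aut_one aut_inv aut_mul.
Proof. by move=> f; apply/autP => x; exact: aut_funK. Qed.

Fact aut_mulgV : right_inverse aut_one aut_inv aut_mul.
Proof. by move=> f; apply/autP => x; exact: aut_inv_funK. Qed.

HB.instance Definition _ := isGroup.Build (aut G)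
  aut_mulA aut_mul1g aut_mulg1 aut_mulVg aut_mulgV.

End AutomorphismGroup.

Definition isomorphic (G H : groupType) : Prop :=
  exists f : {multiplicative G -> H}, bijective f.

Definition left_coset (G : groupType) (H : {pred G}) (x : G) : set G :=
  [set x * h | h in [set h | h \in H]].

Definition finite_index (G : groupType) (H K : {pred G}) : Prop :=
  {subset H <= K} /\ finite_set [set left_coset H x | x in [set x | x \in K]].

Definition commensurable (G G' : groupType) : Prop :=
  exists (H : groupClosed G) (H' : groupClosed G'),
    [/\ finite_index H predT, finite_index H' predT
      & isomorphic (subg H) (subg H')].

Definition cyclic_group (G : groupType) : Prop :=
  exists g : G, forall x : G, exists k : nat, x = g ^+ k \/ x = g ^- k.

(* [H] is normal in [K] with cyclic quotient; [N] is [H] seen inside [K]. *)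
Definition cyclic_step (G : groupType) (H K : groupClosed G) : Prop :=
  {subset H <= K} /\
  exists2 N : normal_subgroup (subg K),
    (forall x : subg K, (x \in N) = (val x \in H)) & cyclic_group (quot N).

Definition polycyclic (G : groupType) : Prop :=
  exists (m : nat) (S : nat -> groupClosed G),
    [/\ S 0 =i pred1 1, S m =i predT
      & forall i, (i < m)%N -> cyclic_step (S i) (S i.+1)].

Definition polycyclic_by_finite (G : groupType) : Prop :=
  exists2 H : groupClosed G, polycyclic (subg H) & finite_index H predT.

Definition maximal_finite_normal (G : groupType) (N : normal_subgroup G) :=
  finite_set [set x | x \in N] /\
  forall M : normal_subgroup G,
    finite_set [set x | x \in M] -> {subset N <= M} -> M =i N.

(* Unlike the {'GL_n[F]} of matrix, [F] need not be finite and [n] may be 0. *)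
Definition GL (n : nat) (F : comUnitRingType) := {A : 'M[F]_n | A \in unitmx}.

Section GeneralLinearGroup.
Variables (n : nat) (F : comUnitRingType).
Implicit Types A B : GL n F.

HB.instance Definition _ := SubChoice.on (GL n F).

Definition GL_one : GL n F := exist _ 1%:M%R (unitmx1 F n).

Fact GL_mul_unit A B : (val A *m val B)%R \in unitmx.
Proof. by rewrite unitmx_mul (valP A) (valP B). Qed.
Definition GL_mul A B : GL n F := exist (fun M => M \in unitmx) _ (GL_mul_unit A B).

Fact GL_inv_unit A : invmx (val A) \in unitmx.
Proof. by rewrite unitmx_inv (valP A). Qed.
Definition GL_inv A : GL n F := exist (fun M => M \in unitmx) _ (GL_inv_unit A).

Fact GL_mulA : associative GL_mul.
Proof. by move=> A B C; apply/val_inj; rewrite /= mulmxA. Qed.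

Fact GL_mul1g : left_id GL_one GL_mul.
Proof. by move=> A; apply/val_inj; rewrite /= mul1mx. Qed.

Fact GL_mulg1 : right_id GL_one GL_mul.
Proof. by move=> A; apply/val_inj; rewrite /= mulmx1. Qed.

Fact GL_mulVg : left_inverse GL_one GL_inv GL_mul.
Proof. by move=> A; apply/val_inj; rewrite /= mulVmx ?(valP A). Qed.

Fact GL_mulgV : right_inverse GL_one GL_inv GL_mul.
Proof. by move=> A; apply/val_inj; rewrite /= mulmxV ?(valP A). Qed.

HB.instance Definition _ := isGroup.Build (GL n F)
  GL_mulA GL_mul1g GL_mulg1 GL_mulVg GL_mulgV.

End GeneralLinearGroup.

Section ArithmeticGroups.
Variable R : realType.
Local Notation C := R[i].

(* The polynomials are in the [n * n] matrix entries, ordered by [mxvec];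
   GL(n, C) being open in the matrices, allowing also [1 / det] would define
   the same subsets of GL(n, C). *)
Definition Q_defined (n : nat) (G : {pred GL n C}) : Prop :=
  exists P : set (mpoly.mpoly (n * n) rat),
    forall A : GL n C, A \in G <->
      forall p, P p ->
        mpoly.mmap (@ratr C) (fun k => mxvec (val A) 0%R k) p = 0%R.

(* The points of [G] in GL(n, S): the entries of the inverse are in [S] too. *)
Definition points (S : {pred C}) (n : nat) (G : {pred GL n C}) :
    {pred GL n C} :=
  [pred A | [&& A \in G, val A \is a mxOver S & val A^-1 \is a mxOver S]].

Definition Z_points := points (mem (range (fun m : int => m%:~R%R : C))).
Definition Q_points := points (mem (range (@ratr C))).

Definition arithmetic_subgroup (n : nat) (D G : groupClosed (GL n C)) : Prop :=
  let DZ := [predI D & Z_points G] in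
  [/\ {subset D <= Q_points G}, finite_index DZ D
    & finite_index DZ (Z_points G)].

Definition arithmetic_group (Gam : groupType) : Prop :=
  exists (n : nat) (G D : groupClosed (GL n C)),
    [/\ Q_defined G, arithmetic_subgroup D G & isomorphic Gam (subg D)].

End ArithmeticGroups.

(* Main.v *)
From HB Require Import structures.
Require Import Defs.
From mathcomp Require Import all_boot monoid reals.
From mathcomp Require Import ssralg ssrint matrix perm zmodp rat.
From mathcomp Require Import boolp classical_sets cardinality complex.
From mathcomp Require Import -(notations) mpoly.

(** Write p : Gam -> Gam/tau.  Polycyclic-by-finite groups are finitely generated
    and virtually torsion-free, so there is a homomorphism r from Gam to a
    finite group whose kernel is torsion-free.  As tau is finite, it meets the
    kernel of r trivially, and x |-> (p x, r x) is injective.  This turns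
    automorphisms of Gam that preserve r into automorphisms of Gam/tau and back:
    let A consist of the automorphisms f of Gam with r o f = r, and let B consist
    of the automorphisms g of Gam/tau such that every x has a companion y with
    g (p x) = p y and r y = r x.  The companion is unique, so x |-> y is an
    automorphism of Gam in A that lifts g.  Since tau is characteristic, there is
    a homomorphism from Aut(Gam) to Aut(Gam/tau), and it maps A isomorphically
    onto B ([quot_aut_restricts_iso]).  Both subgroups have finite index, because
    a homomorphism from a finitely generated group to a finite group is
    determined by finitely many values in a finite set.  This is the
    commensurability.

    Being arithmetic passes to subgroups of finite index, which gives the last
    claim.  It does not pass to overgroups of finite index in general; what saves
    the second claim is that the isomorphism from A to B is the restriction of a
    homomorphism defined on all of Aut(Gam).  With s : Aut(Gam) -> Sym(m) the action on the cosets of A,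
    whose kernel lies in A, the pair formed by that homomorphism and s embeds
    Aut(Gam) as a subgroup of finite index in Aut(Gam/tau) x Sym(m).  If
    Aut(Gam/tau) is arithmetic in an algebraic group X, the product is arithmetic
    in the group of block diagonal matrices with blocks in X and in the
    permutation matrices, and the latter are cut out by polynomials with rational
    coefficients ([arithmetic_group_restricts_iso]).

    Virtual torsion-freeness goes up the polycyclic series
    ([cyclic_extension_vtf]): if N is normal in G with G/N generated by the coset
    of t, a torsion-free subgroup of finite index in N can be chosen
    characteristic, say M, as the common kernel of all homomorphisms from N to a
    fixed finite group.  Then M, if G/N is finite, or the group generated by t and
    M, if G/N is infinite, is torsion-free of finite index in G. *)

Set Implicit Arguments.
Unset Strict Implicit.
Unset Printing Implicit Defensive.

Import GRing.Theory.
Local Open Scope classical_set_scope.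
Local Open Scope group_scope.

(** * Homomorphisms and subgroups *)

Section Homs.
Variables (G H : groupType).

Definition hom_of (f : G -> H) (fM : {morph f : x y / x * y}) :
  {multiplicative G -> H} := HB.pack f (isMultiplicative.Build G H f fM).

Variable f : {multiplicative G -> H}.

Lemma hom1 : f 1 = 1.
Proof. by apply: (@mulgI _ (f 1)); rewrite -gmulfM !mulg1. Qed.

Lemma homV : {morph f : x / x^-1}.
Proof. by move=> x; apply: (@mulgI _ (f x)); rewrite -gmulfM !mulgV hom1. Qed.

Lemma homX n : {morph f : x / x ^+ n}.
Proof. by elim: n => [|n IHn] x; rewrite ?hom1 // !expgS gmulfM IHn. Qed.

Lemma hom_div x y : f x = f y <-> f (x^-1 * y) = 1.
Proof.
rewrite gmulfM homV; split=> [->|/(congr1 ( *%g (f x)))]; first exact: mulVg.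
by rewrite mulVKg mulg1.
Qed.

End Homs.

Lemma inj_surj_bij (T U : Type) (f : T -> U) :
  injective f -> (forall y, exists x, f x = y) -> bijective f.
Proof.
move=> fI fsurj; pose g y := projT1 (cid (fsurj y)).
have gK : cancel g f by move=> y; exact: projT2 (cid (fsurj y)).
by exists g => // x; apply: fI; rewrite gK.
Qed.

Section SubgroupOf.
Variables (G : groupType) (P : G -> Prop) (P1 : P 1).
Hypothesis PF : forall x y, P x -> P y -> P (x * y^-1).

Let S : {pred G} := [pred x | `[< P x >]].

Fact subgroup_of_closed : group_closed S.
Proof.
split=> [|x y]; first exact/asboolP.
by move=> /asboolP xP /asboolP yP; apply/asboolP/PF.
Qed.

Definition subgroup_of : groupClosed G := HB.pack S
  (isInvClosed.Build G S (group_closedV subgroup_of_closed))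
  (isMul1Closed.Build G S subgroup_of_closed.1)
  (isMulClosed.Build G S (group_closedM subgroup_of_closed)).

Lemma in_subgroup_of x : x \in subgroup_of <-> P x.
Proof. by split=> [/asboolP|xP]; last exact/asboolP. Qed.

End SubgroupOf.

(** * Finite index and finite quotients *)

(** A finite-valued function that tells the cosets of [H] in [K] apart.  Unlike
    a finite set of cosets, such functions restrict to subsets of [K] and make
    sense before [H] is known to be a group. *)
Definition separates_cosets (G : groupType) (H K : {pred G})
    (T : finType) (f : G -> T) :=
  forall x y, x \in K -> y \in K -> f x = f y -> x^-1 * y \in H.

Lemma coset_representatives (G : groupType) (H K : {pred G}) (T : finType)
    (f : G -> T) :
  separates_cosets H K f ->
  exists r : T -> G,
    forall x, x \in K -> [/\ r (f x) \in K, f (r (f x)) = f x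
                           & (r (f x))^-1 * x \in H].
Proof.
move=> fsep.
exists (fun t => if pselect (exists2 x, x \in K & f x = t) is left e
                 then s2val (cid2 e) else 1) => x Kx.
case: pselect => [e|[]]; last by exists x.
by case: cid2 => y /= Ky fyx; split=> //; exact: fsep.
Qed.

Lemma group_pred_closed (G : groupType) (H : groupClosed G) : group_closed H.
Proof. by split; [exact: gpred1 | exact: gpredF]. Qed.

Lemma finite_indexP (G : groupType) (H K : {pred G}) :
  group_closed H ->
  finite_index H K <->
  {subset H <= K} /\ exists (T : finType) (f : G -> T), separates_cosets H K f.
Proof.
move=> clH; have HM := group_closedM clH.
split=> -[sHK fin]; split=> //.
  have [s sE] := (finite_seqP _).1 fin.
  exists 'I_(size s).+1, (fun x => inord (index (left_coset H x) s)).
  move=> x y Kx Ky /(congr1 val) /=.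
  have in_s z : z \in K -> left_coset H z \in s.
    move=> Kz; have: [set` s] (left_coset H z) by rewrite -sE; exists z.
    by [].
  rewrite !inordK ?ltnS ?index_size //.
  move=> /(index_inj (setT : set G) (in_s x Kx) (in_s y Ky)) E.
  have: left_coset H y y by exists 1 => /=; rewrite ?clH.1 ?mulg1.
  by rewrite -E => -[h /= Hh <-]; rewrite mulKg.
have [T [f fsep]] := fin; have [r rP] := coset_representatives fsep.
apply: (@sub_finite_set _ _ [set left_coset H (r t) | t in [set: T]]); last first.
  by apply: finite_image; exact: finite_finset.
move=> _ [x /= Kx <-]; exists (f x) => //; have [Kr fr _] := rP x Kx.
have same u v : u \in K -> v \in K -> f u = f v ->
    left_coset H u `<=` left_coset H v.
  move=> Ku Kv fuv _ [h /= Hh <-]; exists (v^-1 * u * h).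
    by apply: HM => //; apply: fsep.
  by rewrite !mulgA mulgV mul1g.
by apply/seteqP; split; exact: same.
Qed.

Lemma finite_index_predT (G : groupType) (H : groupClosed G) (T : finType)
    (f : G -> T) :
  (forall x y, f x = f y -> x^-1 * y \in H) -> finite_index H predT.
Proof.
move=> fsep; apply/(finite_indexP _ (group_pred_closed H)); split=> //.
by exists T, f => x y _ _ /fsep.
Qed.

Lemma separate_predT (G : groupType) (H : groupClosed G) :
  finite_index H predT ->
  exists (T : finType) (f : G -> T), separates_cosets H predT f.
Proof. by move=> /(finite_indexP _ (group_pred_closed H))[]. Qed.

Lemma separates_cosets_trans (G : groupType) (H K L : {pred G})
    (T U : finType) (f : G -> T) (g : G -> U) :
  separates_cosets H K f -> separates_cosets L H g ->
  exists (V : finType) (h : G -> V), separates_cosets L K h.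
Proof.
move=> /[dup] fsep /coset_representatives[r rP] gsep.
exists (T * U)%type, (fun x => (f x, g ((r (f x))^-1 * x))).
move=> x y Kx Ky [fxy gxy].
have [_ _ rx] := rP x Kx; have [_ _ ry] := rP y Ky; have := gsep _ _ rx ry gxy.
by rewrite fxy invgM invgK -mulgA mulVKg.
Qed.

(** An element that acts trivially on the left cosets of [H] fixes the coset [H]
    itself, hence lies in [H]. *)
Lemma finite_index_perm (G : groupType) (H : groupClosed G) :
  finite_index H predT ->
  exists m (s : {multiplicative G -> 'S_m}), forall x, s x = 1 -> x \in H.
Proof.
move=> /separate_predT[T [f fsep]].
(* [c x] is the coset of [x], encoded by the values that [f] takes on it. *)
pose c (x : G) :=
  enum_rank [set t | `[< exists2 h, h \in H & f (x * h) = t >]]%SET.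
have cP x y : c x = c y <-> x^-1 * y \in H.
  split=> [/enum_rank_inj/setP/(_ (f x))|xyH].
    rewrite !inE; have -> : `[< exists2 h, h \in H & f (x * h) = f x >].
      by apply/asboolP; exists 1; rewrite ?gpred1 ?mulg1.
    move/esym/asboolP=> [h hH /(fsep _ _ isT isT)].
    rewrite invgM -mulgA gpredMl ?gpredV // => yxH.
    by rewrite -gpredV invgM invgK.
  congr enum_rank; apply/setP => t; rewrite !inE.
  apply/asboolP/asboolP => -[h hH <-].
    exists (y^-1 * x * h); last by rewrite !mulgA mulgV mul1g.
    by apply: gpredM => //; rewrite -gpredV invgM invgK.
  exists (x^-1 * y * h); last by rewrite !mulgA mulgV mul1g.
  exact: gpredM.
(* The action is by the inverse because permutations compose from left to
   right; values of [t] that encode no coset are fixed. *)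
pose act g t := if pselect (exists x, c x = t) is left e
  then c (g^-1 * projT1 (cid e)) else t.
have actE g x : act g (c x) = c (g^-1 * x).
  rewrite /act; case: pselect => [e|[]]; last by exists x.
  case: cid => y /= /cP yx; apply/cP.
  by rewrite invgM invgK -!mulgA mulVKg.
have act0 g t : ~ (exists x, c x = t) -> act g t = t.
  by rewrite /act; case: pselect.
have actM g h t : act (g * h) t = act h (act g t).
  have [[x <-]|nt] := pselect (exists x, c x = t).
    by rewrite !actE invgM mulgA.
  by rewrite !act0.
have act1 t : act 1 t = t.
  have [[x <-]|nt] := pselect (exists x, c x = t).
    by rewrite actE invg1 mul1g.
  by rewrite act0.
have act_inj g : injective (act g).
  by apply: (can_inj (g := act g^-1)) => t; rewrite -actM mulgV act1.
have permM : {morph (fun g => perm (@act_inj g)) : x y / x * y}.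
  by move=> g h; apply/permP => t; rewrite permM !permE actM.
exists _, (hom_of permM) => x /= /permP/(_ (c 1)).
by rewrite permE perm1 actE mulg1 => /cP; rewrite invgK mulg1.
Qed.

(** * Finitely generated and virtually torsion-free groups *)

Definition finitely_generated (G : groupType) : Prop :=
  exists s : seq G, forall H : groupClosed G, {subset s <= H} -> H =i predT.

Definition torsion_free_kernel (G H : groupType) (f : {multiplicative G -> H}) :=
  forall x n, f x = 1 -> x ^+ n.+1 = 1 -> x = 1.

Definition virtually_torsion_free (G : groupType) : Prop :=
  exists m (f : {multiplicative G -> 'S_m}), torsion_free_kernel f.

Lemma finite_index_torsion_free (G : groupType) (H : groupClosed G) :
  finite_index H predT ->
  (forall x n, x \in H -> x ^+ n.+1 = 1 -> x = 1) -> virtually_torsion_free G.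
Proof.
move=> /finite_index_perm[m [s sH]] tfH.
by exists m, s => x n /sH; apply: tfH.
Qed.

Lemma hom_eq_generated (G H : groupType) (s : seq G)
    (f g : {multiplicative G -> H}) :
  (forall K : groupClosed G, {subset s <= K} -> K =i predT) ->
  {in s, f =1 g} -> f =1 g.
Proof.
move=> sgen fg x; pose E z := f z = g z.
have E1 : E 1 by rewrite /E !hom1.
have EF z w : E z -> E w -> E (z * w^-1).
  by rewrite /E !gmulfM !homV => -> ->.
apply/(in_subgroup_of E1 EF); rewrite (sgen (subgroup_of E1 EF)) // => w /fg fgw.
exact/in_subgroup_of.
Qed.

(** There are finitely many homomorphisms to a fixed finite group, each one
    given by its values [v] on the generators, so the map that evaluates all of
    them at a point has a finite range. *)
Lemma separate_homs (G : groupType) m :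
  finitely_generated G ->
  exists (T : finType) (c : G -> T), forall x y, c x = c y ->
    forall h : {multiplicative G -> 'S_m}, h x = h y.
Proof.
move=> [s sgen].
pose agree (v : {ffun 'I_(size s) -> 'S_m}) (h : {multiplicative G -> 'S_m}) :=
  forall i : 'I_(size s), h (nth 1 s i) = v i.
pose c x := [ffun v => if pselect (exists h, agree v h) is left e
                       then projT1 (cid e) x else 1].
exists {ffun {ffun 'I_(size s) -> 'S_m} -> 'S_m}, c => x y /ffunP cxy h.
have := cxy [ffun i : 'I_(size s) => h (nth 1 s i)]; rewrite !ffunE.
case: pselect => [e|[]]; last by exists h => i; rewrite ffunE.
case: cid => h' /= h'h.
have hE : h' =1 h.
  apply: hom_eq_generated sgen _ => _ /(nthP 1)[i lt_i <-].
  by have := h'h (Ordinal lt_i); rewrite ffunE.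
by rewrite !hE.
Qed.

Section Quotient.
Variables (G : groupType) (N : normal_subgroup G).

Definition quot_hom : {multiplicative G -> quot N} :=
  hom_of (fun x y => esym (@quot_piM G N x y)).

Lemma quot_hom1 x : quot_hom x = 1 <-> x \in N.
Proof.
rewrite -(hom1 quot_hom); split=> [/esym/quot_piP|xN].
  by rewrite invg1 mul1g.
by apply/esym/quot_piP; rewrite invg1 mul1g.
Qed.

Lemma quot_homK x : quot_hom (repr x) = x.
Proof. exact: quot_reprK. Qed.

Lemma quot_homP x y : quot_hom x = quot_hom y <-> x^-1 * y \in N.
Proof. exact: quot_piP. Qed.

End Quotient.

Definition to_subg (G : groupType) (H : groupClosed G) (x : G) (xH : x \in H) :
  subg H := exist _ x xH.

Lemma subg_inj (G : groupType) (H : groupClosed G) (x y : subg H) :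
  val x = val y -> x = y.
Proof. exact: val_inj. Qed.

Lemma subgM (G : groupType) (H : groupClosed G) (x y : subg H) :
  val (x * y) = val x * val y.
Proof. by []. Qed.

Lemma subgX (G : groupType) (H : groupClosed G) (x : subg H) n :
  val (x ^+ n) = val x ^+ n.
Proof. by elim: n => // n IHn; rewrite !expgS subgM IHn. Qed.

Section CyclicExtension.
Variables (G : groupType) (N : normal_subgroup G).
Hypothesis cycN : cyclic_group (quot N).

Lemma cyclic_extension_fg : finitely_generated (subg N) -> finitely_generated G.
Proof.
move=> [s sgen]; have [g gP] := cycN.
exists (repr g :: [seq val x | x <- s]) => H sH x.
have tH : repr g \in H by apply: sH; rewrite mem_head.
pose E (y : subg N) := val y \in H.
have E1 : E 1 by exact: gpred1.
have EF y z : E y -> E z -> E (y * z^-1) by exact: gpredF.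
have sNH y : y \in N -> y \in H.
  move=> yN; apply/(in_subgroup_of E1 EF (to_subg yN)).
  rewrite (sgen (subgroup_of E1 EF)) // => z sz; apply/in_subgroup_of.
  by apply: sH; rewrite inE map_f ?orbT.
have [k] := gP (quot_hom N x); rewrite inE -{1 2}(quot_homK g).
rewrite -homX -homV => -[]/esym/quot_homP/sNH; rewrite gpredMl //.
  by rewrite gpredV gpredXn.
by rewrite gpredV gpredXNn.
Qed.

(** If [N] has a torsion-free subgroup of finite index, it has a characteristic
    one, [M].  Only the order of the cyclic quotient decides how [M] has to be
    enlarged to have finite index in [G]; adding a [t] of infinite order modulo
    [N] creates no torsion, since torsion elements have degree 0 in [t]. *)
Lemma cyclic_extension_vtf :
  finitely_generated (subg N) -> virtually_torsion_free (subg N) ->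
  virtually_torsion_free G.
Proof.
move=> fgN [m [r tfr]]; have [g gP] := cycN; set t := repr g.
have tg : quot_hom N t = g by exact: quot_homK.
have [T [c csep]] := separate_homs m fgN.
(* [M] is the common kernel of all homomorphisms from [N] to 'S_m.  Conjugation
   by elements of [G] permutes these homomorphisms, so [M] is normal in [G]. *)
pose M (x : G) := exists2 y : subg N, val y = x &
  forall h : {multiplicative subg N -> 'S_m}, h y = 1.
have M1 : M 1 by exists 1 => // h; rewrite hom1.
have MF x y : M x -> M y -> M (x * y^-1).
  case=> u <- hu [v <- hv]; exists (u * v^-1) => // h.
  by rewrite gmulfM homV hu hv invg1 mulg1.
have MM x y : M x -> M y -> M (x * y).
  move=> Mx My; rewrite -[y]invgK; apply: (MF) => //.
  by rewrite -[_^-1]mul1g; exact: MF.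
have MJ x k : M x -> M (x ^ k).
  case=> u <- hu.
  pose J (v : subg N) : subg N := to_subg (nsubJ k (valP v)).
  have JM : {morph J : v w / v * w}.
    by move=> v w; apply: subg_inj; rewrite /= conjMg.
  exists (J u) => // h.
  by have := hu (h \o hom_of JM : {multiplicative _ -> _}).
have MN x : M x -> x \in N by case=> u <- _; exact: valP.
have M_tf x n : M x -> x ^+ n.+1 = 1 -> x = 1.
  case=> u <- hu un1; have -> // : u = 1.
  by apply: (tfr u n); [exact: hu | apply: subg_inj; rewrite subgX].
have cM u v : c u = c v -> M (val (u^-1 * v)).
  move=> /csep cuv; exists (u^-1 * v) => // h.
  by apply: (hom_div h u v).1; exact: cuv.
have [[e teN]|tN] := pselect (exists e, t ^+ e.+1 \in N).
  have ge1 : g ^+ e.+1 = 1 by rewrite -tg -homX; apply/quot_hom1.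
  have deco x : exists iu : 'I_e.+1 * subg N, x = t ^+ iu.1 * val iu.2.
    have [k xg] : exists k, quot_hom N x = g ^+ k.
      have [k [->|->]] := gP (quot_hom N x); first by exists k.
      (* As g^(e+1) = 1, the inverse of g^k is g^(k e). *)
      exists (k * e)%N; apply: mulg1_eq.
      by rewrite -expgnDr -mulnS mulnC expgnA ge1 expg1n.
    have lt_k : (k %% e.+1 < e.+1)%N by rewrite ltn_mod.
    have tkx : t ^- (k %% e.+1) * x \in N.
      apply/quot_homP; rewrite xg homX tg {2}(divn_eq k e.+1).
      by rewrite expgnDr mulnC expgnA ge1 expg1n mul1g.
    by exists (Ordinal lt_k, to_subg tkx); rewrite /= mulVKg.
  pose d x := projT1 (cid (deco x)).
  have dE x : x = t ^+ (d x).1 * val (d x).2 by exact: projT2 (cid (deco x)).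
  apply: (finite_index_torsion_free (H := subgroup_of M1 MF)); last first.
    by move=> x n /in_subgroup_of; exact: M_tf.
  apply: (@finite_index_predT _ _ ('I_e.+1 * T)%type
    (fun x => ((d x).1, c (d x).2))).
  move=> x y [xy /cM Mxy]; apply/in_subgroup_of.
  suff -> : x^-1 * y = val ((d x).2^-1 * (d y).2) by [].
  by rewrite {1}(dE x) {1}(dE y) xy invgM -mulgA mulKg.
(* Now [t] has infinite order modulo [N], so the group [L] generated by [t] and
   [M] still meets [N] in [M].  Membership of [x] in [L] is expressed with natural
   exponents only, as [x] in t^-i M t^j. *)
pose L x := exists i j, M (t ^+ i * x * t ^- j).
have L1 : L 1 by exists 0, 0; rewrite invg1 !mulg1.
have LF x y : L x -> L y -> L (x * y^-1).
  move=> [i [j Mx]] [k [l My]]; exists (l + i)%N, (j + k)%N.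
  have -> : t ^+ (l + i) * (x * y^-1) * t ^- (j + k) =
      (t ^+ i * x * t ^- j) ^ (t ^- l) * (t ^+ k * y * t ^- l)^-1 ^ (t ^- j).
    have tC : t ^+ j * t ^+ l = t ^+ l * t ^+ j by rewrite -!expgnDr addnC.
    rewrite /conjg !invgM !invgK !expgnDr invgM !mulgA -(mulgA _ (t ^+ j)) tC.
    by rewrite !gnorm.
  by apply: MM; apply: (MJ); rewrite // -[_^-1]mul1g; exact: MF.
have gI : injective (fun i => g ^+ i).
  have lt_g i j : (i < j)%N -> g ^+ i <> g ^+ j.
    move=> ij gij; apply: tN; exists (j - i).-1; rewrite prednK ?subn_gt0 //.
    by apply/quot_hom1; rewrite homX tg expgnFr 1?ltnW // gij mulgV.
  by move=> i j gij; case: (ltngtP i j) => // /lt_g; rewrite gij.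
have LE x : L x -> exists i j, quot_hom N x = g ^- i * g ^+ j /\ (i = j -> M x).
  move=> [i [j Mx]]; exists i, j; split=> [|ij]; last first.
    have := MJ _ (t ^+ i) Mx; rewrite -ij /conjg.
    by rewrite -!mulgA mulKg mulVg mulg1.
  have /quot_hom1 := MN _ Mx; rewrite !gmulfM homV !homX tg => /divg1_eq <-.
  by rewrite mulKg.
(* Every [x] is an element of [N] times a power of [t], and the latter lies in
   [L]; so the cosets of [M] in [N] account for all cosets of [L] in [G]. *)
have deco x : exists u : subg N, L ((val u)^-1 * x).
  have [k xk] := gP (quot_hom N x).
  have [s [Ls sx]] : exists s, L s /\ quot_hom N s = quot_hom N x.
    case: xk => ->; [exists (t ^+ k) | exists (t ^- k)]; rewrite ?homV homX tg.
      by split=> //; exists 0, k; rewrite mul1g mulgV.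
    by split=> //; exists k, 0; rewrite mulgV invg1 mulg1.
  have xsN : x * s^-1 \in N by apply/quot_hom1; rewrite gmulfM homV sx mulgV.
  by exists (to_subg xsN); rewrite /= invgM invgK mulgVK.
pose d x := projT1 (cid (deco x)).
have dL x : L ((val (d x))^-1 * x) by exact: projT2 (cid (deco x)).
apply: (finite_index_torsion_free (H := subgroup_of L1 LF)); last first.
  move=> x n /in_subgroup_of/LE[i [j [xE ijM]]] xn1.
  apply: (M_tf x n _ xn1); apply: ijM; apply/eqP.
  rewrite -(eqn_pmul2r (ltn0Sn n)); apply/eqP/gI; rewrite /= !expgnA.
  have := congr1 (quot_hom N) xn1; rewrite homX hom1 xE.
  have gC : commute (g ^- i) (g ^+ j).
    by apply/commute_sym/commuteV/commuteX2/commute_refl.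
  by rewrite expgMn // expVgn => /mulg1_eq; rewrite invgK.
apply: (@finite_index_predT _ _ T (fun x => c (d x))) => x y /cM Mxy.
have ML z : M z -> L z by exists 0, 0; rewrite expg0 invg1 mulg1 mul1g.
have Lx := (in_subgroup_of L1 LF _).2 (dL x).
have Ly := (in_subgroup_of L1 LF _).2 (dL y).
have Lxy := (in_subgroup_of L1 LF _).2 (ML _ Mxy).
have -> : x^-1 * y = ((val (d x))^-1 * x)^-1 *
    (val ((d x)^-1 * d y) * ((val (d y))^-1 * y)).
  by rewrite -[val (_ * _)]/((val (d x))^-1 * val (d y)) invgM invgK !gnorm.
by apply: gpredM; [rewrite gpredV | apply: gpredM].
Qed.

End CyclicExtension.

(** * Polycyclic-by-finite groups *)

Lemma finitely_generated_surj (G H : groupType) (f : {multiplicative G -> H}) :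
  (forall y, exists x, f x = y) -> finitely_generated G -> finitely_generated H.
Proof.
move=> fsurj [s sgen]; exists [seq f x | x <- s] => K sK y.
pose E x := f x \in K.
have E1 : E 1 by rewrite /E hom1 gpred1.
have EF u v : E u -> E v -> E (u * v^-1).
  by rewrite /E gmulfM homV; exact: gpredF.
have [x <-] := fsurj y; apply/(in_subgroup_of E1 EF).
rewrite (sgen (subgroup_of E1 EF)) // => z sz; apply/in_subgroup_of.
by apply: sK; rewrite map_f.
Qed.

Lemma virtually_torsion_free_inj (G H : groupType)
    (f : {multiplicative G -> H}) :
  injective f -> virtually_torsion_free H -> virtually_torsion_free G.
Proof.
move=> fI [m [r tfr]].
exists m, (r \o f : {multiplicative _ -> _}) => x n /= rx xn1; apply: fI.
by rewrite hom1; apply: (tfr _ n rx); rewrite -homX xn1 hom1.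
Qed.

Lemma cyclic_step_fg_vtf (G : groupType) (H K : groupClosed G) :
  cyclic_step H K ->
  finitely_generated (subg H) /\ virtually_torsion_free (subg H) ->
  finitely_generated (subg K) /\ virtually_torsion_free (subg K).
Proof.
(* [N] is [H] seen inside [K]: [up] and [down] are the isomorphisms between the
   two, to which both properties are transported. *)
move=> [sHK [N NE cycN]] [fgH vtfH].
have NH (y : subg N) : val (val y) \in H by rewrite -NE; exact: valP.
pose down (y : subg N) : subg H := to_subg (NH y).
have downM : {morph down : x y / x * y} by move=> x y; exact: subg_inj.
have down_inj : injective down.
  by move=> x y /(congr1 val) xy; apply/val_inj/val_inj.
have HN (x : subg H) : to_subg (sHK _ (svalP x)) \in N.
  by rewrite NE; exact: (svalP x).
pose up (x : subg H) : subg N := to_subg (HN x).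
have upM : {morph up : x y / x * y}.
  by move=> x y; apply: subg_inj; exact: subg_inj.
have fgN : finitely_generated (subg N).
  apply: (@finitely_generated_surj _ _ (hom_of upM) _ fgH) => y.
  by exists (down y); apply: subg_inj; exact: subg_inj.
have vtfN : virtually_torsion_free (subg N).
  exact: (@virtually_torsion_free_inj _ _ (hom_of downM) down_inj vtfH).
split; first exact: cyclic_extension_fg cycN fgN.
exact: cyclic_extension_vtf cycN fgN vtfN.
Qed.

Lemma polycyclic_fg_vtf (G : groupType) :
  polycyclic G -> finitely_generated G /\ virtually_torsion_free G.
Proof.
move=> [m [S [S0 Sm Sstep]]].
suff fgS_vtfS : forall i, (i <= m)%N ->
    finitely_generated (subg (S i)) /\ virtually_torsion_free (subg (S i)).
  have [fgS vtfS] := fgS_vtfS m (leqnn m).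
  pose full x : subg (S m) := to_subg (etrans (Sm x) isT).
  have fullM : {morph full : x y / x * y} by move=> x y; exact: subg_inj.
  have valM : {morph (fun x : subg (S m) => val x) : x y / x * y} by [].
  split.
    apply: (@finitely_generated_surj _ _ (hom_of valM) _ fgS) => x.
    by exists (full x).
  by apply: (@virtually_torsion_free_inj _ _ (hom_of fullM) _ vtfS) => x y [].
elim=> [_|i IHi lt_i]; last first.
  exact: cyclic_step_fg_vtf (Sstep i lt_i) (IHi (ltnW lt_i)).
have triv (x : subg (S 0)) : x = 1.
  by apply: subg_inj; apply/eqP; rewrite -[_ == _](S0 (val x)) (valP x).
split; first by exists [::] => H _ x; rewrite (triv x) gpred1.
have oneM : {morph (fun _ : subg (S 0) => 1 : 'S_0) : x y / x * y}.
  by move=> x y; rewrite mulg1.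
by exists 0%N, (hom_of oneM).
Qed.

Lemma finite_extension_fg (G : groupType) (H : groupClosed G) :
  finite_index H predT -> finitely_generated (subg H) -> finitely_generated G.
Proof.
move=> /separate_predT[T [f /coset_representatives[r rP]]] [s sgen].
have rH x : (r (f x))^-1 * x \in H by have [] := rP x isT.
exists ([seq r t | t <- enum T] ++ [seq val x | x <- s]) => K sK x.
pose E (y : subg H) := val y \in K.
have E1 : E 1 by exact: gpred1.
have EF y z : E y -> E z -> E (y * z^-1) by exact: gpredF.
have /(in_subgroup_of E1 EF) : to_subg (rH x) \in subgroup_of E1 EF.
  rewrite (sgen (subgroup_of E1 EF)) // => z sz; apply/in_subgroup_of.
  by apply: sK; rewrite mem_cat map_f ?orbT.
by rewrite /E /= gpredMl // gpredV sK // mem_cat map_f ?mem_enum.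
Qed.

Lemma finite_extension_vtf (G : groupType) (H : groupClosed G) :
  finite_index H predT -> virtually_torsion_free (subg H) ->
  virtually_torsion_free G.
Proof.
move=> /separate_predT[T [f /coset_representatives[r rP]]] [m [s tfs]].
have rH x : (r (f x))^-1 * x \in H by have [] := rP x isT.
(* [L] is the kernel of [s] as a subgroup of [G]. *)
pose L (x : G) := exists2 y : subg H, val y = x & s y = 1.
have L1 : L 1 by exists 1; rewrite ?hom1.
have LF x y : L x -> L y -> L (x * y^-1).
  move=> [u <- su] [v <- sv]; exists (u * v^-1) => //.
  by rewrite gmulfM homV su sv invg1 mulg1.
apply: (finite_index_torsion_free (H := subgroup_of L1 LF)); last first.
  move=> x n /in_subgroup_of[u <- su] un1.
  by rewrite (tfs u n su) //; apply: subg_inj; rewrite subgX.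
apply: (@finite_index_predT _ _ (T * 'S_m)%type
  (fun x => (f x, s (to_subg (rH x))))) => x y [fxy /hom_div sxy].
apply/in_subgroup_of; eexists; last exact: sxy.
rewrite -[LHS]/(((r (f x))^-1 * x)^-1 * ((r (f y))^-1 * y)).
by rewrite fxy invgM invgK -mulgA mulVKg.
Qed.

Lemma polycyclic_by_finite_fg_vtf (G : groupType) :
  polycyclic_by_finite G -> finitely_generated G /\ virtually_torsion_free G.
Proof.
move=> [H /polycyclic_fg_vtf[fgH vtfH] iH].
by split; [exact: finite_extension_fg fgH | exact: finite_extension_vtf vtfH].
Qed.

(** * Automorphisms modulo the maximal finite normal subgroup *)

Section MaximalFiniteNormal.
Variables (G : groupType) (tau : normal_subgroup G).
Hypothesis tau_max : maximal_finite_normal tau.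

(** The product of two finite normal subgroups is one as well, so a maximal one is
    the largest one; in particular it is invariant under automorphisms. *)
Lemma finite_normal_sub (M : normal_subgroup G) :
  finite_set [set x | x \in M] -> {subset M <= tau}.
Proof.
have [fin_tau max_tau] := tau_max => finM.
pose P (x : G) := exists2 m, m \in M & m^-1 * x \in tau.
have P1 : P 1 by exists 1; rewrite ?invg1 ?mulg1 ?gpred1.
have PF x y : P x -> P y -> P (x * y^-1).
  move=> [m mM mx] [n nM ny]; exists (m * n^-1); first by rewrite gpredM ?gpredV.
  have -> : (m * n^-1)^-1 * (x * y^-1) = (m^-1 * x * (n^-1 * y)^-1) ^ n^-1.
    by rewrite /conjg !invgM !invgK !gnorm.
  by apply: nsubJ; rewrite gpredM ?gpredV.
have PJ x y : x \in subgroup_of P1 PF -> x ^ y \in subgroup_of P1 PF.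
  move=> /in_subgroup_of[m mM mx]; apply/in_subgroup_of; exists (m ^ y).
    exact: nsubJ.
  by rewrite -conjVg -conjMg; apply: nsubJ.
suff E : NormalSubgroup PJ =i tau.
  move=> m mM; rewrite -E; apply/in_subgroup_of.
  by exists m; rewrite ?mulVg ?gpred1.
apply: max_tau => [|x xtau]; last first.
  by apply/in_subgroup_of; exists 1; rewrite ?gpred1 // invg1 mul1g.
have := finite_image (fun xy => xy.1 * xy.2) (finite_setX finM fin_tau).
apply: sub_finite_set => x /in_subgroup_of[m mM mx].
by exists (m, m^-1 * x); rewrite /= ?mulVKg.
Qed.

Lemma aut_finite_normal (f : aut G) x : f x \in tau <-> x \in tau.
Proof.
have sub (h : aut G) y : y \in tau -> h y \in tau.
  pose P (y : G) := exists2 z, z \in tau & h z = y.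
  have P1 : P 1 by exists 1; rewrite ?gpred1 ?hom1.
  have PF u v : P u -> P v -> P (u * v^-1).
    move=> [z ztau <-] [w wtau <-]; exists (z * w^-1); first by rewrite gpredF.
    by rewrite gmulfM homV.
  have PJ u v : u \in subgroup_of P1 PF -> u ^ v \in subgroup_of P1 PF.
    move=> /in_subgroup_of[z ztau <-]; apply/in_subgroup_of.
    have [w <-] := aut_surj h v; exists (z ^ w); first exact: nsubJ.
    by rewrite /conjg !gmulfM homV.
  move=> ytau; apply: (@finite_normal_sub (NormalSubgroup PJ)); last first.
    by apply/in_subgroup_of; exists y.
  have := finite_image h tau_max.1; apply: sub_finite_set.
  by move=> u /in_subgroup_of[z ztau <-]; exists z.
by split=> [/(sub f^-1)|]; [rewrite [_ (f x)]aut_funK | exact: sub].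
Qed.

(** A finite subgroup consists of torsion elements. *)
Lemma torsion_free_kernel_tau (H : groupType) (r : {multiplicative G -> H}) x :
  torsion_free_kernel r -> x \in tau -> r x = 1 -> x = 1.
Proof.
move=> tfr xtau rx1; have [s sE] := (finite_seqP _).1 tau_max.1.
have [[n xn1]|ninf] := pselect (exists n, x ^+ n.+1 = 1); first exact: tfr xn1.
have xI : injective (fun i => x ^+ i).
  have lt_x i j : (i < j)%N -> x ^+ i <> x ^+ j.
    move=> ij xij; apply: ninf; exists (j - i).-1; rewrite prednK ?subn_gt0 //.
    by rewrite expgnFr 1?ltnW // xij mulgV.
  by move=> i j xij; case: (ltngtP i j) => // /lt_x; rewrite xij.
suff : (size [seq x ^+ i | i <- iota 0 (size s).+1] <= size s)%N.
  by rewrite size_map size_iota ltnn.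
apply: uniq_leq_size; first by rewrite map_inj_uniq ?iota_uniq.
move=> _ /mapP[i _ ->]; have : [set` s] (x ^+ i) by rewrite -sE /= gpredXn.
by [].
Qed.

Definition quot_map (f : aut G) (x : quot tau) : quot tau :=
  quot_hom tau (f (repr x)).

Lemma quot_mapE f x : quot_map f (quot_hom tau x) = quot_hom tau (f x).
Proof.
apply/quot_homP; rewrite -homV -gmulfM; apply/aut_finite_normal/quot_homP.
exact: quot_homK.
Qed.

Lemma quot_mapM f : {morph quot_map f : x y / x * y}.
Proof.
move=> x y; rewrite -[x]quot_homK -[y]quot_homK -gmulfM !quot_mapE -gmulfM.
by rewrite -gmulfM.
Qed.

Lemma quot_mapK f : cancel (quot_map f) (quot_map f^-1).
Proof.
move=> x; rewrite -[x]quot_homK !quot_mapE; congr (quot_hom _ _).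
exact: aut_funK.
Qed.

Lemma quot_mapVK f : cancel (quot_map f^-1) (quot_map f).
Proof. by move=> x; rewrite -{1}[f]invgK quot_mapK. Qed.

Definition quot_aut (f : aut G) : aut (quot tau) :=
  Aut (aut_fun := hom_of (quot_mapM f)) (Bijective (quot_mapK f) (quot_mapVK f)).

Lemma quot_autE f x : quot_aut f (quot_hom tau x) = quot_hom tau (f x).
Proof. exact: quot_mapE. Qed.

Lemma quot_autM : {morph quot_aut : f g / f * g}.
Proof.
move=> f g; apply: autP => x; rewrite -[x]quot_homK quot_autE.
by rewrite -[RHS]/(quot_aut f (quot_aut g _)) !quot_autE.
Qed.

End MaximalFiniteNormal.

(** Stronger than an isomorphism between [A] and [B], because [f] is defined on
    the whole group: this is what passes arithmeticity from [H] to [G]. *)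
Definition restricts_iso (G H : groupType) (f : {multiplicative G -> H})
    (A : {pred G}) (B : {pred H}) :=
  [/\ forall x, x \in A -> f x \in B, {in A &, injective f}
    & forall y, y \in B -> exists2 x, x \in A & f x = y].

Lemma restricts_isomorphic (G H : groupType) (f : {multiplicative G -> H})
    (A : groupClosed G) (B : groupClosed H) :
  restricts_iso f A B -> isomorphic (subg A) (subg B).
Proof.
move=> [fAB finj fsurj].
pose F (x : subg A) : subg B := to_subg (fAB _ (svalP x)).
have FM : {morph F : x y / x * y}.
  by move=> x y; apply: subg_inj; exact: gmulfM.
exists (hom_of FM); apply: inj_surj_bij => [x y /(congr1 val) /= xy|y].
  exact/subg_inj/(finj _ _ (svalP x) (svalP y) xy).
have [x xA xy] := fsurj _ (svalP y).
by exists (to_subg xA); apply: subg_inj.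
Qed.

Section CommensurableAut.
Variables (G : groupType) (tau : normal_subgroup G).
Hypothesis tau_max : maximal_finite_normal tau.
Variables (m : nat) (r : {multiplicative G -> 'S_m}).
Hypotheses (tfr : torsion_free_kernel r) (fgG : finitely_generated G).

Let p := quot_hom tau.
Let Q := quot_aut tau_max.

(** [tau] and the kernel of [r] meet trivially. *)
Lemma quot_pair_inj x y : p x = p y -> r x = r y -> x = y.
Proof.
move=> /quot_homP xy /hom_div rxy.
have := torsion_free_kernel_tau tau_max tfr xy rxy.
by move/mulg1_eq; rewrite invgK.
Qed.

Let fixes_r (f : aut G) := forall x, r (f x) = r x.

Fact fixes_r1 : fixes_r 1. Proof. by []. Qed.

Fact fixes_rF f g : fixes_r f -> fixes_r g -> fixes_r (f * g^-1).
Proof.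
move=> rf rg x; rewrite -[(f * _) x]/(f (g^-1 x)) rf -rg.
by congr (r _); exact: aut_inv_funK.
Qed.

Definition aut_fixing : groupClosed (aut G) := subgroup_of fixes_r1 fixes_rF.

(** A lift of [f] to an automorphism of [G] that preserves [r] must send [x] to a
    [y] as below, and [quot_pair_inj] says that there is at most one. *)
Let lifts (f : aut (quot tau)) :=
  forall x, exists2 y, f (p x) = p y & r y = r x.

Fact lifts1 : lifts 1. Proof. by move=> x; exists x. Qed.

Fact liftsF f g : lifts f -> lifts g -> lifts (f * g^-1).
Proof.
move=> lf lg x; rewrite -[(f * _) _]/(f (g^-1 (p x))).
pose u := repr (g^-1 (p x)); have pu : p u = g^-1 (p x) by exact: quot_homK.
have [z gz rz] := lg u; have zx : p (z^-1 * x) = 1.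
  by apply: (hom_div p z x).1; rewrite -gz pu; exact: aut_inv_funK.
have [y fy ry] := lf (u * (z^-1 * x)); exists y.
  by rewrite -fy -pu gmulfM zx mulg1.
by rewrite ry gmulfM gmulfM homV rz mulVKg.
Qed.

Definition aut_liftable : groupClosed (aut (quot tau)) :=
  subgroup_of lifts1 liftsF.

(** The left coset of [f] is determined by r o f^-1, which is one of the finitely
    many homomorphisms to 'S_m. *)
Lemma aut_fixing_finite_index : finite_index aut_fixing predT.
Proof.
have [s sgen] := fgG.
apply: (@finite_index_predT _ _ {ffun 'I_(size s) -> 'S_m}
  (fun f : aut G =>
     [ffun i : 'I_(size s) => r ((f^-1 : aut G) (nth 1 s i))])) => f g /ffunP fg.
apply/in_subgroup_of => x.
have rfg : r \o (f^-1 : aut G) =1 r \o (g^-1 : aut G).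
  apply: (hom_eq_generated sgen) => _ /(nthP 1)[i lt_i <-] /=.
  by have := fg (Ordinal lt_i); rewrite !ffunE.
by rewrite [LHS](rfg (g x)) /=; congr (r _); exact: aut_funK.
Qed.

(** The argument for [aut_fixing], with the values of [r] at representatives of
    f^-1 (p x) for the generators [x]: two automorphisms with the same values
    agree, up to a change of these representatives by [tau], at every [x]. *)
Lemma aut_liftable_finite_index : finite_index aut_liftable predT.
Proof.
have [s sgen] := fgG.
apply: (@finite_index_predT _ _ {ffun 'I_(size s) -> 'S_m}
  (fun f : aut (quot tau) => [ffun i : 'I_(size s) =>
     r (repr ((f^-1 : aut (quot tau)) (p (nth 1 s i))))])).
move=> f g /ffunP fg; apply/in_subgroup_of.
pose E x := exists y z, [/\ f^-1 (p x) = p y, g^-1 (p x) = p z & r y = r z].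
have E1 : E 1 by exists 1, 1; rewrite !hom1.
have EF x x' : E x -> E x' -> E (x * x'^-1).
  move=> [y [z [fy gz yz]]] [y' [z' [fy' gz' yz']]].
  by exists (y * y'^-1), (z * z'^-1); rewrite !gmulfM !homV fy fy' gz gz' yz yz'.
have allE x : E x.
  apply/(in_subgroup_of E1 EF); rewrite (sgen (subgroup_of E1 EF)) // => w.
  move=> /(nthP 1)[i lt_i <-]; apply/in_subgroup_of.
  exists (repr (f^-1 (p (nth 1 s i)))), (repr (g^-1 (p (nth 1 s i)))).
  by rewrite !quot_homK; split=> //; have := fg (Ordinal lt_i); rewrite !ffunE.
move=> x; have [y [z [fy gz yz]]] := allE (repr (g (p x))).
have zx : p z = p x by rewrite -gz quot_homK; exact: aut_funK.
exists (y * (z^-1 * x)).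
  have /hom_div zx1 := zx.
  by rewrite gmulfM zx1 mulg1 -fy quot_homK.
by rewrite !gmulfM homV yz mulVKg.
Qed.

Let lift f (lf : lifts f) x : G := s2val (cid2 (lf x)).

Let liftP f (lf : lifts f) x : f (p x) = p (lift lf x).
Proof. exact: s2valP (cid2 (lf x)). Qed.

Let lift_r f (lf : lifts f) x : r (lift lf x) = r x.
Proof. exact: s2valP' (cid2 (lf x)). Qed.

Let liftM f (lf : lifts f) : {morph lift lf : x y / x * y}.
Proof.
move=> x y; apply: quot_pair_inj; last by rewrite gmulfM !lift_r gmulfM.
by rewrite gmulfM -!liftP !gmulfM.
Qed.

Let liftK f g (lf : lifts f) (lg : lifts g) :
  cancel f g -> cancel (lift lf) (lift lg).
Proof.
move=> fK x; apply: quot_pair_inj; last by rewrite !lift_r.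
by rewrite -!liftP fK.
Qed.

(** Injectivity and surjectivity both come from the injectivity of
    x |-> (p x, r x): an automorphism that preserves [r] is determined by what it
    induces on the quotient, and the unique choice of [lift] is multiplicative
    and inverted by the lift of the inverse. *)
Lemma quot_aut_restricts_iso :
  restricts_iso (hom_of (quot_autM tau_max)) aut_fixing aut_liftable.
Proof.
split=> [f /in_subgroup_of rf|f g /in_subgroup_of rf /in_subgroup_of rg fg|f].
- by apply/in_subgroup_of => x; exists (f x); rewrite ?rf //; exact: quot_autE.
- apply: autP => x; apply: quot_pair_inj; last by rewrite rf rg.
  have := congr1 (fun h : aut (quot tau) => h (p x)) fg.
  by rewrite /= !quot_mapE.
move=> lf0; have /in_subgroup_of lf := lf0.
have /in_subgroup_of lg : f^-1 \in aut_liftable by rewrite gpredV.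
have lfK := liftK lf lg (aut_funK f); have lgK := liftK lg lf (aut_inv_funK f).
pose F : aut G := Aut (aut_fun := hom_of (liftM lf)) (Bijective lfK lgK).
exists F; first by apply/in_subgroup_of => x; exact: lift_r.
by apply: autP => x; rewrite -[x]quot_homK [LHS]quot_autE (liftP lf).
Qed.

End CommensurableAut.

(** * Block matrices with a permutation block *)

(** The permutation matrices as an algebraic set: the products say that rows and
    columns have at most one nonzero entry, and the row sums say that this entry
    exists and is 1. *)
Lemma perm_mxP (F : idomainType) (m : nat) (M : 'M[F]_m) :
  (exists s, M = perm_mx s) <->
  [/\ forall i j k, j != k -> (M i j * M i k = 0)%R,
      forall i j k, i != k -> (M i j * M k j = 0)%R
    & forall i, (\sum_j M i j = 1)%R].
Proof.
split=> [[s ->]|[Mrow Mcol Msum]].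
  have sE i j : perm_mx s i j = (s i == j)%:R%R :> F by rewrite !mxE.
  split=> [i j k jk|i j k ik|i]; rewrite ?sE.
  - by rewrite -natrM mulnb; case: eqP => // ->; rewrite (negPf jk).
  - rewrite -natrM mulnb; case: eqP => // <-.
    by rewrite (inj_eq perm_inj) eq_sym (negPf ik).
  rewrite (bigD1 (s i)) //= big1 ?sE ?eqxx ?addr0 // => j.
  by rewrite sE eq_sym => /negPf ->.
have row_nz i : exists j, M i j != 0%R.
  apply/existsP; apply: contraT => /existsPn Mi0.
  suff : (\sum_j M i j == 0)%R by rewrite Msum oner_eq0.
  by rewrite big1 // => j _; apply/eqP; rewrite -[_ == _]negbK.
pose f i := xchoose (row_nz i).
have f_nz i : M i (f i) != 0%R by exact: (xchooseP (row_nz i)).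
have fI : injective f.
  move=> i k fik; apply/eqP; apply: contraT => /(Mcol i (f i) k)/eqP.
  by rewrite mulf_eq0 (negPf (f_nz i)) fik (negPf (f_nz k)).
have M0 i j : j != f i -> M i j = 0%R.
  move=> /(Mrow i _ _)/eqP; rewrite mulf_eq0 (negPf (f_nz i)) orbF.
  by move/eqP.
exists (perm fI); apply/matrixP => i j; rewrite !mxE permE.
have [<-|fij] := eqVneq (f i) j; last by rewrite M0 1?eq_sym.
by rewrite -(Msum i) (bigD1 (f i)) //= big1 ?addr0 // => k; exact: M0.
Qed.

Section PermBlock.
Variables (F : comUnitRingType) (n m : nat).
Implicit Types (A B : GL n F) (s t : 'S_m).

Fact perm_block_unit A s :
  block_mx (val A) 0%R 0%R (perm_mx s) \in unitmx.
Proof.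
by rewrite unitmxE det_ublock unitrM -!unitmxE (svalP A) unitmx_perm.
Qed.

Definition perm_block A s : GL (n + m) F :=
  exist (fun M => M \in unitmx) _ (perm_block_unit A s).

Lemma perm_blockM A B s t :
  perm_block (A * B) (s * t) = perm_block A s * perm_block B t.
Proof.
apply/val_inj; rewrite /= mulmx_block perm_mxM.
by rewrite !mulmx0 !mul0mx !addr0 !add0r.
Qed.

Lemma perm_block1 : perm_block 1 1 = 1.
Proof. by apply: (@mulgI _ (perm_block 1 1)); rewrite -perm_blockM !mulg1. Qed.

Lemma perm_blockV A s : perm_block A^-1 s^-1 = (perm_block A s)^-1.
Proof. by apply/esym/mulg1_eq; rewrite -perm_blockM !mulgV perm_block1. Qed.

Lemma perm_block_inj A B s t :
  perm_block A s = perm_block B t -> A = B /\ s = t.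
Proof.
move=> /(congr1 val) /eq_block_mx[AB _ _ st].
split; first exact: val_inj.
apply/permP => i; have /matrixP/(_ i (t i)) := st; rewrite !mxE eqxx.
by case: eqP => // _ /eqP; rewrite eq_sym oner_eq0.
Qed.

End PermBlock.

(** * Arithmetic groups *)

Section PermBlockGroup.
Variables (R : realType) (n m : nat) (G : groupClosed (GL n R[i])).
Local Notation C := R[i].

Let in_block (M : GL (n + m) C) :=
  exists2 A, A \in G & exists s : 'S_m, M = perm_block A s.

Fact in_block1 : in_block 1.
Proof. by exists 1; [exact: gpred1 | exists 1; rewrite perm_block1]. Qed.

Fact in_blockF M N : in_block M -> in_block N -> in_block (M * N^-1).
Proof.
move=> [A GA [s ->]] [B GB [t ->]]; exists (A * B^-1); first exact: gpredF.
by exists (s * t^-1); rewrite -perm_blockV -perm_blockM.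
Qed.

Definition perm_block_group : groupClosed (GL (n + m) C) :=
  subgroup_of in_block1 in_blockF.

Lemma perm_blockP M :
  M \in perm_block_group <->
  exists2 A, A \in G & exists s : 'S_m, M = perm_block A s.
Proof. exact: in_subgroup_of. Qed.

Let ev N (M : GL N C) := mmap (@ratr C) (fun k => mxvec (val M) 0%R k).
Let var N (i j : 'I_N) : mpoly (N * N) rat := mpolyX rat (mnm1 (mxvec_index i j)).
Let lsh (i : 'I_n) : 'I_(n + m) := lshift m i.
Let rsh (i : 'I_m) : 'I_(n + m) := rshift n i.

Let evM N (M : GL N C) p q : ev M (p * q)%R = (ev M p * ev M q)%R.
Proof. exact: rmorphM. Qed.

Let ev_sum1 N (M : GL N C) k (p : 'I_k -> mpoly (N * N) rat) :
  ev M (\sum_j p j - 1)%R = (\sum_j ev M (p j) - 1)%R.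
Proof. by rewrite /ev rmorphB rmorph1 rmorph_sum. Qed.

Let ev_var N (M : GL N C) i j : ev M (var i j) = val M i j.
Proof. by rewrite /ev mmapX mmap1U mxvecE. Qed.

(** [p] on the entries of the upper left block. *)
Let lift_ul (p : mpoly (n * n) rat) : mpoly ((n + m) * (n + m)) rat :=
  mmap (@mpolyC ((n + m) * (n + m)) rat)
    (fun k => let ij : 'I_n * 'I_n := mxvec_indexP k in
              var (lsh ij.1) (lsh ij.2)) p.

Let ev_lift_ul A s p : ev (perm_block A s) (lift_ul p) = ev A p.
Proof.
rewrite /ev /lift_ul [X in mmap _ _ X]/mmap rmorph_sum /=.
apply: eq_bigr => k _; rewrite rmorphM /= mmapC /mmap1 rmorph_prod.
congr (_ * _)%R; apply: eq_bigr => i _; rewrite rmorphXn; congr (_ ^+ _)%R.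
case: i / (mxvec_indexP i) => i j; rewrite mxvecE.
by apply: etrans (ev_var (perm_block A s) _ _) _; rewrite /= block_mxEul.
Qed.

(** Equations of the blocks: those of [G] on the upper left block, zeros off the
    diagonal, and those of the permutation matrices on the lower right block. *)
Lemma Q_defined_perm_block : Q_defined G -> Q_defined perm_block_group.
Proof.
move=> [P GP].
pose eqs (q : mpoly ((n + m) * (n + m)) rat) :=
  [\/ exists2 p, P p & q = lift_ul p,
      exists i j, q = var (lsh i) (rsh j) \/ q = var (rsh j) (lsh i),
      exists i j k, j != k /\
        (q = var (rsh i) (rsh j) * var (rsh i) (rsh k) \/
         q = var (rsh j) (rsh i) * var (rsh k) (rsh i))%R
    | exists i, q = (\sum_j var (rsh i) (rsh j) - 1)%R].
exists [set q | eqs q] => M; split.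
  move=> /perm_blockP[A GA [s ->]] q.
  have [srow scol ssum] := (perm_mxP (perm_mx s : 'M[C]_m)).1 (ex_intro _ s erefl).
  case=> [[p Pp ->]|[i [j [->|->]]]|[i [j [k [jk [->|->]]]]]|[i ->]].
  - by apply: etrans (ev_lift_ul A s p) _; exact: (GP A).1 GA p Pp.
  - by apply: etrans (ev_var _ _ _) _; rewrite /= block_mxEur mxE.
  - by apply: etrans (ev_var _ _ _) _; rewrite /= block_mxEdl mxE.
  - by apply: etrans (evM _ _ _) _; rewrite !ev_var /= !block_mxEdr srow.
  - by apply: etrans (evM _ _ _) _; rewrite !ev_var /= !block_mxEdr scol.
  apply: etrans (ev_sum1 _ _) _; apply/eqP; rewrite subr_eq0 -(ssum i).
  by apply/eqP; apply: eq_bigr => j _; rewrite ev_var /= block_mxEdr.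
move=> Meqs; set N := val M : 'M_(n + m).
have ur : ursubmx N = 0%R.
  apply/matrixP => i j; rewrite !mxE -ev_var; apply: Meqs.
  by constructor 2; exists i, j; left.
have dl : dlsubmx N = 0%R.
  apply/matrixP => i j; rewrite !mxE -ev_var; apply: Meqs.
  by constructor 2; exists j, i; right.
have [s drs] : exists s, drsubmx N = perm_mx s.
  apply/perm_mxP; split=> [i j k jk|i j k ik|i].
  - rewrite !mxE -!ev_var -evM; apply: Meqs.
    by constructor 3; exists i, j, k; split=> //; left.
  - rewrite !mxE -!ev_var -evM; apply: Meqs.
    by constructor 3; exists j, i, k; split=> //; right.
  have ev0 : ev M (\sum_j var (rsh i) (rsh j) - 1)%R = 0%R.
    by apply: Meqs; constructor 4; exists i.
  have {ev0} := etrans (esym (ev_sum1 _ _)) ev0 => /subr0_eq; apply: etrans.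
  by apply: eq_bigr => j _; rewrite !mxE ev_var.
have NE : N = block_mx (ulsubmx N) 0%R 0%R (perm_mx s).
  by rewrite -ur -dl -drs submxK.
(* The upper left block is invertible because the whole matrix is. *)
have ulU : ulsubmx N \in unitmx.
  have : N \in unitmx := svalP M.
  rewrite {1}NE !unitmxE det_ublock unitrM.
  by case/andP.
pose A : GL n C := exist (fun B => B \in unitmx) _ ulU.
have ME : M = perm_block A s by exact/val_inj.
apply/perm_blockP; exists A; last by exists s.
apply/GP => p Pp; rewrite -[LHS](ev_lift_ul A s) -ME; apply: Meqs.
by constructor 1; exists p.
Qed.

End PermBlockGroup.

Section Points.
Variables (R : realType).
Local Notation C := R[i].

Lemma range_subring_closed (D : nzRingType) (f : {rmorphism D -> C}) :
  GRing.subring_closed (mem (range f)).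
Proof.
split=> [|x y|x y].
- by apply/mem_set; exists 1%R; rewrite ?rmorph1.
- move=> /set_mem[a _ <-] /set_mem[b _ <-].
  by apply/mem_set; exists (a - b)%R; rewrite ?rmorphB.
move=> /set_mem[a _ <-] /set_mem[b _ <-].
by apply/mem_set; exists (a * b)%R; rewrite ?rmorphM.
Qed.

Variable S : {pred C}.
Hypothesis subringS : GRing.subring_closed S.

Let S1 : 1%R \in S. Proof. by case: subringS. Qed.
Let SB x y : x \in S -> y \in S -> (x - y)%R \in S.
Proof. by case: subringS => _ + _; apply. Qed.
Let SM x y : x \in S -> y \in S -> (x * y)%R \in S.
Proof. by case: subringS => _ _; apply. Qed.
Let S0 : 0%R \in S. Proof. by rewrite -(subrr 1%R) SB. Qed.
Let SD x y : x \in S -> y \in S -> (x + y)%R \in S.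
Proof. by move=> Sx Sy; rewrite -[y]opprK -[(- y)%R]sub0r !SB. Qed.

Lemma mxOver_mulmx n (A B : 'M[C]_n) :
  A \is a mxOver S -> B \is a mxOver S -> (A *m B)%R \is a mxOver S.
Proof.
move=> /mxOverP SA /mxOverP SB'; apply/mxOverP => i j; rewrite !mxE.
elim/big_ind: _ => [|x y|k _]; [exact: S0 | exact: SD | exact: SM].
Qed.

Lemma points_closed n (G : groupClosed (GL n C)) : group_closed (points S G).
Proof.
split=> [|A B].
  by rewrite inE gpred1 invg1 /= !mxOver_scalar.
rewrite !inE => /and3P[GA SA SA'] /and3P[GB SB' SB''].
by rewrite gpredF // invgF /= !mxOver_mulmx.
Qed.

Lemma mxOver_perm_block n m (A : GL n C) (s : 'S_m) :
  (val (perm_block A s) \is a mxOver S) = (val A \is a mxOver S).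
Proof.
apply/mxOverP/mxOverP => SA a b.
  by have := SA (lshift m a) (lshift m b); rewrite /= block_mxEul.
rewrite -(splitK a) -(splitK b).
case: (fintype.split a) => a'; case: (fintype.split b) => b' /=.
- by rewrite block_mxEul.
- by rewrite block_mxEur mxE.
- by rewrite block_mxEdl mxE.
by rewrite block_mxEdr !mxE; case: eqP.
Qed.

Lemma points_perm_block n m (G : groupClosed (GL n C)) A (s : 'S_m) :
  (perm_block A s \in points S (perm_block_group m G)) = (A \in points S G).
Proof.
rewrite !inE -perm_blockV !mxOver_perm_block; congr andb.
apply/idP/idP => [/perm_blockP[B GB [t /perm_block_inj[-> _]]]|GA] //.
by apply/perm_blockP; exists A => //; exists s.
Qed.

End Points.

Lemma group_closedI (G : groupType) (H : groupClosed G) (K : {pred G}) :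
  group_closed K -> group_closed [predI H & K].
Proof.
move=> [K1 KF]; split=> [|u v]; first by rewrite inE /= gpred1 K1.
rewrite !inE => /andP[Hu Ku] /andP[Hv Kv]; rewrite gpredF //.
exact: KF.
Qed.

(** The kernel of [f] meets [A] trivially, so the action [s] of [H] on the cosets
    of [A] detects it: [F], made of [f] and [s], embeds [H] in the product of
    the arithmetic group with a finite group of permutation matrices.  The image
    has finite index because the image of the kernel of [s] already has finite
    index in the first factor, and arithmetic subgroups stay arithmetic when
    they are replaced by a subgroup of finite index. *)
Lemma arithmetic_group_restricts_iso (R : realType) (G H : groupType)
    (f : {multiplicative H -> G}) (A : groupClosed H) (B : groupClosed G) :
  finite_index A predT -> finite_index B predT -> restricts_iso f A B ->
  arithmetic_group R G -> arithmetic_group R H.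
Proof.
move=> /finite_index_perm[m [s sA]] /separate_predT[T0 [f0 f0sep]].
move=> [_ fI fsurj] [n [X [D [QX [DQ DZ_D DZ_Z] [i i_bij]]]]].
set C := R[i].
have subZ := range_subring_closed (R := R) intr.
have clZ := points_closed subZ X.
have clDZ := group_closedI D clZ.
have [sDZ [T1 [f1 f1sep]]] := (finite_indexP _ clDZ).1 DZ_D.
have [_ [T2 [f2 f2sep]]] := (finite_indexP _ clDZ).1 DZ_Z.
pose e x : GL n C := val (i (f x)).
have eM : {morph e : x y / x * y} by move=> x y; rewrite /e !gmulfM.
pose F x := perm_block (e x) (s x).
have FM : {morph F : x y / x * y}.
  by move=> x y; rewrite /F eM gmulfM perm_blockM.
have FI : injective F.
  move=> x y /perm_block_inj[/val_inj exy /hom_div sxy].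
  have fxy : f x = f y by exact: bij_inj i_bij _ _ exy.
  have /mulg1_eq : x^-1 * y = 1; last by rewrite invgK.
  apply: fI; rewrite ?gpred1 ?sA //.
  by rewrite hom1; apply: (hom_div f x y).1.
(* The image of the kernel of [s] has finite index in [G], hence in [D]; so it
   meets the integral points of [X] in a subgroup of finite index. *)
pose K : {pred G} := [pred b | `[< exists2 x, s x = 1 & f x = b >]].
pose L : {pred GL n C} := [pred M | `[< exists2 x, s x = 1 & e x = M >]].
have [V1 [h1 h1sep]] : exists (V : finType) (h : G -> V),
    separates_cosets K predT h.
  pose g b := if pselect (exists2 x, x \in A & f x = b) is left w
              then s (s2val (cid2 w)) else 1.
  apply: (separates_cosets_trans f0sep (g := g)) => b c Bb Bc.
  rewrite /g; case: pselect => [w|[]]; last exact: fsurj.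
  case: pselect => [w'|[]]; last exact: fsurj.
  case: cid2 => x /= _ <-; case: cid2 => y /= _ <- /hom_div sxy.
  by apply/asboolP; exists (x^-1 * y); rewrite // gmulfM homV.
have [V2 [h2 h2sep]] : exists (V : finType) (h : GL n C -> V),
    separates_cosets L D h.
  pose d M := if pselect (exists b, val (i b) = M) is left w
              then projT1 (cid w) else 1.
  have dE M : M \in D -> val (i (d M)) = M.
    move=> DM; rewrite /d; case: pselect => [w|[]]; first by case: cid.
    have [j _ jK] := i_bij; by exists (j (to_subg DM)); rewrite jK.
  exists V1, (h1 \o d) => M N DM DN /= /(h1sep _ _ isT isT)/asboolP[x sx fx].
  apply/asboolP; exists x => //.
  by rewrite /e fx gmulfM homV -[in RHS](dE M DM) -[in RHS](dE N DN).
have [V3 [h3 h3sep]] : exists (V : finType) (h : GL n C -> V),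
    separates_cosets L (Z_points X) h.
  apply: (separates_cosets_trans f2sep (g := h2)) => M N.
  by move=> /andP[DM _] /andP[DN _]; exact: h2sep.
(* The two blocks of a matrix of the form [perm_block]. *)
pose dec (M : GL (n + m) C) : GL n C * 'S_m :=
  if pselect (exists p, perm_block p.1 p.2 = M) is left w
  then projT1 (cid w) else (1, 1).
have decE M t : dec (perm_block M t) = (M, t).
  rewrite /dec; case: pselect => [w|[]]; last by exists (M, t).
  by case: cid => -[N u] /= /perm_block_inj[-> ->].
pose P M := exists x, F x = M.
have P1 : P 1 by exists 1; exact: (hom1 (hom_of FM)).
have PF M N : P M -> P N -> P (M * N^-1).
  move=> [x <-] [y <-]; exists (x * y^-1).
  by rewrite FM; congr (_ * _); exact: (homV (hom_of FM)).
pose E := subgroup_of P1 PF; pose Y := perm_block_group m X.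
have FE x : F x \in E by apply/in_subgroup_of; exists x.
have eD x : e x \in D by exact: (svalP (i (f x))).
have clYZ := points_closed subZ Y.
have clEZ := group_closedI E clYZ.
have subQ := range_subring_closed (R := R) ratr.
exists (n + m)%N, Y, E; split; first exact: Q_defined_perm_block.
  split.
  - move=> M /in_subgroup_of[x <-].
    by rewrite points_perm_block; [exact: DQ | exact: subQ].
  - apply/(finite_indexP _ clEZ); split=> [M /andP[]//|].
    exists T1, (fun M => f1 (dec M).1) => M N EM EN.
    have /in_subgroup_of[x <-] := EM; have /in_subgroup_of[y <-] := EN.
    rewrite !decE /= => /(f1sep _ _ (eD x) (eD y))/andP[_ Zxy].
    have Exy : (F x)^-1 * F y \in E by rewrite gpredM ?gpredV ?FE.
    apply/andP; split; first exact: Exy.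
    by rewrite -perm_blockV -perm_blockM [_ \in _]points_perm_block.
  apply/(finite_indexP _ clEZ); split=> [M /andP[]//|].
  exists (V3 * 'S_m)%type, (fun M => (h3 (dec M).1, (dec M).2)) => M N YM YN.
  have /and3P[/perm_blockP[M' _ [t ME]] _ _] := YM.
  have /and3P[/perm_blockP[N' _ [u NE]] _ _] := YN.
  have ZM : M' \in Z_points X by rewrite -(points_perm_block subZ X _ t) -ME.
  have ZN : N' \in Z_points X by rewrite -(points_perm_block subZ X _ u) -NE.
  rewrite ME NE !decE /= => -[/(h3sep _ _ ZM ZN)/asboolP[x sx xE] tu].
  have FxE : (perm_block M' t)^-1 * perm_block N' u = F x.
    by rewrite /F sx xE -perm_blockV -perm_blockM tu mulVg.
  apply/andP; split; first by rewrite FxE; exact: (FE x).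
  rewrite -ME -NE; apply: (group_closedM clYZ) => //.
  exact: (group_closedV clYZ).
pose G' x : subg E := to_subg (FE x).
have GM : {morph G' : x y / x * y} by move=> x y; apply: subg_inj; exact: FM.
exists (hom_of GM); apply: inj_surj_bij => [x y /(congr1 val)/FI //|y].
have /in_subgroup_of[x xy] := svalP y.
by exists x; apply: subg_inj.
Qed.

(** The inverse of the isomorphism embeds [H] in [G] with image [A]. *)
Lemma arithmetic_group_finite_index (R : realType) (G H : groupType)
    (A : groupClosed G) :
  finite_index A predT -> isomorphic (subg A) H ->
  arithmetic_group R G -> arithmetic_group R H.
Proof.
move=> iA [f [g gK fK]].
have gM : {morph (fun y => val (g y)) : x y / x * y}.
  by move=> x y; rewrite (can2_gmulfM gK fK).
pose T := @subgroup_of H (fun _ => True) I (fun _ _ _ _ => I).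
have inT y : y \in T by exact/in_subgroup_of.
apply: (@arithmetic_group_restricts_iso _ _ _ (hom_of gM) T A) => //.
  by apply: (@finite_index_predT _ _ unit (fun=> tt)) => x y _; exact: inT.
split=> [y _|x y _ _ /val_inj/(can_inj fK) //|x xA]; first exact: (svalP (g y)).
by exists (f (to_subg xA)); rewrite //= gK.
Qed.

Theorem proposition1p6 (R : realType) (Gam : groupType)
    (tau : normal_subgroup Gam) :
  polycyclic_by_finite Gam ->
  maximal_finite_normal tau ->
  [/\ commensurable (aut Gam) (aut (quot tau)),
      arithmetic_group R (aut (quot tau)) -> arithmetic_group R (aut Gam)
    & arithmetic_group R (aut Gam) ->
      exists2 H : groupClosed (aut (quot tau)),
        finite_index H predT & arithmetic_group R (subg H)].
Proof.
move=> /polycyclic_by_finite_fg_vtf[fgG [m [r tfr]]] tau_max.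
have iA := aut_fixing_finite_index r fgG.
have iB := aut_liftable_finite_index tau r fgG.
have AB := quot_aut_restricts_iso tau_max tfr.
have isoAB := restricts_isomorphic AB.
split.
- by exists (aut_fixing r), (aut_liftable tau r).
- exact: arithmetic_group_restricts_iso iA iB AB.
by exists (aut_liftable tau r) => //; apply: arithmetic_group_finite_index isoAB _.
Qed.
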